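(* Let $a$ be a real number. (1) If $a\le\frac{2(\pi-2)}{4-\pi}$, then $$\frac{[\pi(1+a)/2](1-x)^{1/2}}{a+(1+x)^{1/2}}<\arccos x<\frac{(2+\sqrt2\,a)(1-x)^{1/2}}{a+(1+x)^{1/2}},\qquad x\in(0,1).$$ (2) If $\frac{2(\pi-2)}{4-\pi}<a<2\sqrt2$, then $$\frac{8(1-2/a^2)(1-x)^{1/2}}{a+(1+x)^{1/2}}<\arccos x<\frac{\max\{2+\sqrt2\,a,\ \pi(1+a)/2\}(1-x)^{1/2}}{a+(1+x)^{1/2}},\qquad x\in(0,1).$$ (3) If $a\ge2\sqrt2$, then the double inequality in (1) is reversed on $(0,1)$, i.e. $$\frac{(2+\sqrt2\,a)(1-x)^{1/2}}{a+(1+x)^{1/2}}<\arccos x<\frac{[\pi(1+a)/2](1-x)^{1/2}}{a+(1+x)^{1/2}},\qquad x\in(0,1).$$ Moreover, the constants $2+\sqrt2\,a$ and $\frac{\pi}{2}(1+a)$ in the double inequality in (1) (and its reversed form in (3)) and in the upper bound in (2) (where they appear through their maximum) are the best possible.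
   Context: Here $\arccos$ is the principal branch of the inverse cosine, with $\arccos 0=\pi/2$ and $\arccos 1=0$. A constant $C$ (depending on $a$) in a bound of $\arccos x$ by $\frac{C(1-x)^{1/2}}{a+(1+x)^{1/2}}$ valid for all $x\in(0,1)$ is called best possible if, in a lower bound, it cannot be replaced by any larger constant, and, in an upper bound, it cannot be replaced by any smaller constant; in case (2) the constant concerned is $C=\max\{2+\sqrt2\,a,\ \pi(1+a)/2\}$.
   Formalization: In part (1) the assumption a ≥ -1 is added (so that a+(1+x)^{1/2} > 0 on (0,1)); for every a < -1 the stated upper bound on arccos x fails for x near 0. *)

(* Defs.v *)
From Stdlib Require Import Reals.
Open Scope R_scope.

Definition carlson (a C x : R) : R := C * sqrt (1 - x) / (a + sqrt (1 + x)).

(** The two predicates below say only that the constant [C] cannot be improved,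
    not that [C] itself gives a valid bound. *)
Definition best_possible_lower (a C : R) : Prop :=
  forall C', C < C' -> ~ (forall x, 0 < x < 1 -> carlson a C' x < acos x).

Definition best_possible_upper (a C : R) : Prop :=
  forall C', C' < C -> ~ (forall x, 0 < x < 1 -> acos x < carlson a C' x).

(* Main.v *)
(* Put x = cos 2t with 0 < t < pi/4. The best constant at x is
   (sqrt 2 a + 2 cos t) t / sin t, which extends continuously to [0, pi/4] with
   end values 2 + sqrt 2 a and pi (1 + a) / 2. Its derivative has the sign of
   sqrt 2 a - 2 g(t), where g(t) = (t - sin t cos t) / (sin t - t cos t)
   decreases from 2 at 0 to sqrt 2 (pi - 2) / (4 - pi) at pi/4; so it is
   decreasing in case (1), increasing in case (3), and first decreasing then
   increasing in case (2). The lower bound of case (2) holds for all a > 0: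
   minimising over a by AM-GM reduces it to
   27 (t / sin t)^2 > (4 - t cot t)^3. *)
Require Import Defs.
From Stdlib Require Import Reals Lra.
From Coquelicot Require Import Coquelicot.
Open Scope R_scope.

(** * Monotonicity from derivatives, and bounds at endpoints by continuity *)

Lemma derive_pos_lt (f df : R -> R) (a b : R) :
  a < b ->
  (forall x, a <= x <= b -> continuity_pt f x) ->
  (forall x, a < x < b -> is_derive f x (df x)) ->
  (forall x, a < x < b -> 0 < df x) ->
  f a < f b.
Proof.
  intros hab hc hd hp.
  assert (pr1 : forall c, a < c < b -> derivable_pt f c).
  { intros c h; exists (df c); apply is_derive_Reals, hd, h. }
  destruct (MVT f id a b pr1 (fun c _ => derivable_pt_id c) hab hc) as [c [P e]].
  { intros c _; apply derivable_continuous_pt, derivable_pt_id. }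
  rewrite derive_pt_id in e; unfold id in e.
  assert (E : derive_pt f c (pr1 c P) = df c).
  { apply derive_pt_eq_0, is_derive_Reals, hd, P. }
  rewrite E in e; specialize (hp c P).
  assert (0 < (b - a) * df c) by (apply Rmult_lt_0_compat; lra).
  lra.
Qed.

Lemma derive_neg_gt (f df : R -> R) (a b : R) :
  a < b ->
  (forall x, a <= x <= b -> continuity_pt f x) ->
  (forall x, a < x < b -> is_derive f x (df x)) ->
  (forall x, a < x < b -> df x < 0) ->
  f b < f a.
Proof.
  intros hab hc hd hp.
  enough (- f a < - f b) by lra.
  apply (derive_pos_lt (fun x => - f x) (fun x => - df x)); trivial.
  - intros x h; apply (continuity_pt_opp f), hc, h.
  - intros x h; exact (is_derive_opp f x (df x) (hd x h)).
  - intros x h; specialize (hp x h); lra.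
Qed.

Lemma is_derive_continuity_pt (f : R -> R) (x l : R) :
  is_derive f x l -> continuity_pt f x.
Proof.
  intros h; apply derivable_continuous_pt; exists l; now apply is_derive_Reals.
Qed.

(** Meant for repeated use: an expression vanishing at 0 is replaced by its derivative until the
    sign is visible. *)
Lemma derive_pos_pos (f df : R -> R) (b : R) :
  f 0 = 0 ->
  (forall x, is_derive f x (df x)) ->
  (forall x, 0 < x < b -> 0 < df x) ->
  forall x, 0 < x <= b -> 0 < f x.
Proof.
  intros h0 hd hp x hx; rewrite <- h0.
  apply (derive_pos_lt f df); try lra.
  - intros y _; exact (is_derive_continuity_pt f y _ (hd y)).
  - intros y _; apply hd.
  - intros y hy; apply hp; lra.
Qed.

Lemma continuity_ge_endpoint (f : R -> R) (p q e C : R) :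
  p < q -> p <= e <= q -> continuity_pt f e ->
  (forall t, p < t < q -> C <= f t) -> C <= f e.
Proof.
  intros hpq he hc hf.
  destruct (Rle_lt_dec C (f e)) as [h|h]; trivial; exfalso.
  destruct (hc (C - f e)) as [d [hd H]]; [lra|].
  set (m := (p + q) / 2).
  set (l := Rmin (1/2) (d / (2 * (q - p)))).
  assert (hl : 0 < l).
  { apply Rmin_glb_lt; [lra|]; apply Rdiv_lt_0_compat; lra. }
  assert (hl1 : l <= 1/2) by apply Rmin_l.
  assert (hl2 : l * (q - p) < d).
  { apply Rle_lt_trans with (d / (2 * (q - p)) * (q - p)).
    - apply Rmult_le_compat_r; [lra|apply Rmin_r].
    - replace (d / (2 * (q - p)) * (q - p)) with (d / 2) by (field; lra); lra. }
  assert (0 < l * (q - p)) by (apply Rmult_lt_0_compat; lra).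
  (* Moving from [e] towards the midpoint by a fraction [l] stays strictly inside the interval, even
     if [e] is an end, and within [d] of [e]. *)
  set (t := e + l * (m - e)).
  assert (p < t < q) by (unfold t, m; nra).
  specialize (hf t H1).
  assert (hn : Rabs (t - e) < d) by (unfold t, m; apply Rabs_def1; nra).
  (* The limit in [continuity_pt] excludes the point itself; [t = e] happens when [e] is the
     midpoint. *)
  destruct (Req_dec t e) as [E|E]; [rewrite E in hf; lra|].
  specialize (H t); simpl in H; unfold Rdist in H.
  assert (K : Rabs (f t - f e) < C - f e).
  { apply H; split; [split; [exact I|intros E'; now apply E]|exact hn]. }
  apply Rabs_def2 in K; lra.
Qed.

Lemma continuity_le_endpoint (f : R -> R) (p q e C : R) :
  p < q -> p <= e <= q -> continuity_pt f e ->
  (forall t, p < t < q -> f t <= C) -> f e <= C.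
Proof.
  intros hpq he hc hf.
  enough (- C <= - f e) by lra.
  apply (continuity_ge_endpoint (fun t => - f t) p q); trivial.
  - apply (continuity_pt_opp f), hc.
  - intros t ht; specialize (hf t ht); lra.
Qed.

(** * Trigonometric inequalities by iterated differentiation *)

Lemma sin_pos (t : R) : 0 < t <= PI / 2 -> 0 < sin t.
Proof. intros h; generalize PI_RGT_0; intros; apply sin_gt_0; lra. Qed.

Lemma x_cos_lt_sin (t : R) : 0 < t <= PI / 2 -> 0 < sin t - t * cos t.
Proof.
  revert t.
  apply (derive_pos_pos _ (fun t => t * sin t)).
  - rewrite sin_0; ring.
  - intros x; auto_derive; trivial; ring.
  - intros x h; apply Rmult_lt_0_compat; [lra|apply sin_pos; lra].
Qed.

(** Sine and cosine agree at [PI / 4], so [t * cos t < sin t] there says [PI / 4 < 1]. *)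
Lemma PI_lt_4 : PI < 4.
Proof.
  assert (h : 0 < PI / 4 <= PI / 2) by (generalize PI_RGT_0; lra).
  generalize (x_cos_lt_sin _ h) (sin_pos _ h); rewrite <- sin_cos_PI4; nra.
Qed.

(** At [x = 2 * t] this is 4 times [t ^ 2 + t * sin t * cos t - 2 * sin t ^ 2], which decides the
    sign of the derivative of [crit]. The double angle removes products of sines and cosines, so
    three differentiations reach [sin x - x * cos x]. *)
Lemma sqr_x_sin_cos_pos (x : R) :
  0 < x <= PI / 2 -> 0 < x ^ 2 + x * sin x + 4 * cos x - 4.
Proof.
  revert x.
  apply (derive_pos_pos _ (fun x => 2 * x - 3 * sin x + x * cos x)).
  { rewrite sin_0, cos_0; ring. }
  { intros x; auto_derive; trivial; ring. }
  intros x h; assert (hx : 0 < x <= PI / 2) by lra; clear h; revert x hx.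
  apply (derive_pos_pos _ (fun x => 2 - 2 * cos x - x * sin x)).
  { rewrite sin_0; ring. }
  { intros x; auto_derive; trivial; ring. }
  intros x h; assert (hx : 0 < x <= PI / 2) by lra; clear h; revert x hx.
  apply (derive_pos_pos _ (fun x => sin x - x * cos x)).
  { rewrite sin_0, cos_0; ring. }
  { intros x; auto_derive; trivial; ring. }
  intros x h; apply x_cos_lt_sin; lra.
Qed.

(** At [x = 2 * t] this is 4 times the quantity needed in [sinc_inv_sqr_lower]. The fourth
    derivative is a sum of two positive terms. *)
Lemma trig_quartic_pos (x : R) :
  0 < x <= PI / 2 ->
  0 < 16 - 16 * cos x - 7 * (x * sin x) + x ^ 2 * cos x - 2 * x ^ 2.
Proof.
  revert x.
  apply (derive_pos_pos _
    (fun x => 9 * sin x - 5 * (x * cos x) - x ^ 2 * sin x - 4 * x)).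
  { rewrite sin_0, cos_0; ring. }
  { intros x; auto_derive; trivial; ring. }
  intros x h; assert (hx : 0 < x <= PI / 2) by lra; clear h; revert x hx.
  apply (derive_pos_pos _
    (fun x => 4 * cos x + 3 * (x * sin x) - x ^ 2 * cos x - 4)).
  { rewrite sin_0, cos_0; ring. }
  { intros x; auto_derive; trivial; ring. }
  intros x h; assert (hx : 0 < x <= PI / 2) by lra; clear h; revert x hx.
  apply (derive_pos_pos _ (fun x => x * cos x + x ^ 2 * sin x - sin x)).
  { rewrite sin_0, cos_0; ring. }
  { intros x; auto_derive; trivial; ring. }
  intros x h; assert (hx : 0 < x <= PI / 2) by lra; clear h; revert x hx.
  apply (derive_pos_pos _ (fun x => x * sin x + x ^ 2 * cos x)).
  { rewrite sin_0, cos_0; ring. }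
  { intros x; auto_derive; trivial; ring. }
  intros x h.
  assert (0 < x * sin x) by (apply Rmult_lt_0_compat; [lra|apply sin_pos; lra]).
  assert (0 < x ^ 2 * cos x)
    by (apply Rmult_lt_0_compat; [nra|apply cos_gt_0; lra]).
  lra.
Qed.

Lemma sin_cos_sqr (t : R) : sin t * sin t + cos t * cos t = 1.
Proof. generalize (sin2_cos2 t); unfold Rsqr; trivial. Qed.

(** * Monotonicity of the critical-point function *)

(* [ratio a] is critical at [t] iff [sqrt 2 * a = 2 * crit t]. *)
Definition crit (t : R) : R := (t - sin t * cos t) / (sin t - t * cos t).

Lemma crit_decr (t u : R) : 0 < t -> t < u -> u <= PI / 4 -> crit u < crit t.
Proof.
  intros ht htu hu.
  assert (hpi := PI_RGT_0).
  assert (hd : forall x, t <= x <= u -> is_derive crit x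
    (sin x * (2 * sin x ^ 2 - x * sin x * cos x - x ^ 2)
      / (sin x - x * cos x) ^ 2)).
  { intros x hx; assert (h := x_cos_lt_sin x ltac:(lra)).
    assert (e := sin_cos_sqr x).
    assert (hn : is_derive (fun x => x - sin x * cos x) x (2 * sin x ^ 2)).
    { auto_derive; trivial; nra. }
    assert (hm : is_derive (fun x => sin x - x * cos x) x (x * sin x)).
    { auto_derive; trivial; ring. }
    evar_last; [apply (is_derive_div _ _ _ _ _ hn hm); lra|].
    simpl; field; lra. }
  apply (derive_neg_gt crit _ t u htu
    (fun x h => is_derive_continuity_pt _ _ _ (hd x h))
    (fun x h => hd x ltac:(lra))).
  intros x hx.
  assert (h := x_cos_lt_sin x ltac:(lra)).
  assert (hs := sin_pos x ltac:(lra)).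
  assert (hq := sqr_x_sin_cos_pos (2 * x) ltac:(lra)).
  rewrite sin_2a, cos_2a_sin in hq.
  assert (hi : 0 < / (sin x - x * cos x) ^ 2) by (apply Rinv_0_lt_compat; nra).
  assert (0 < sin x * (x ^ 2 + x * sin x * cos x - 2 * sin x ^ 2))
    by (apply Rmult_lt_0_compat; nra).
  unfold Rdiv; nra.
Qed.

(** * The best constant at each point, its end values and its monotonicity *)

(* [t / sin t], extended by continuity to [t = 0]. *)
Definition sinc_inv (t : R) : R := if Req_dec_T t 0 then 1 else t / sin t.

Lemma sinc_inv_eq (t : R) : t <> 0 -> sinc_inv t = t / sin t.
Proof. intros h; unfold sinc_inv; now destruct (Req_dec_T t 0). Qed.

Lemma sinc_inv_0 : sinc_inv 0 = 1.
Proof. unfold sinc_inv; now destruct (Req_dec_T 0 0). Qed.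

Lemma is_derive_sinc_inv (t : R) : 0 < t <= PI / 2 ->
  is_derive sinc_inv t ((sin t - t * cos t) / sin t ^ 2).
Proof.
  intros ht; assert (hs := sin_pos t ht).
  apply (is_derive_ext_loc (fun x => x / sin x)).
  - apply (filter_imp (fun x => 0 < x)); [|apply open_gt; lra].
    intros x hx; symmetry; apply sinc_inv_eq; lra.
  - auto_derive; [lra|]; field; lra.
Qed.

Lemma continuity_sinc_inv (t : R) : 0 <= t <= PI / 2 -> continuity_pt sinc_inv t.
Proof.
  intros [[h|<-] h'].
  - apply (is_derive_continuity_pt _ _ _ (is_derive_sinc_inv t (conj h h'))).
  - apply continuity_pt_filterlim'; rewrite sinc_inv_0.
    assert (L : is_lim sinc_inv 0 1).
    { apply (is_lim_ext_loc (fun x => / (sin x / x))).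
      - exists posreal_one; intros y _ hy; rewrite sinc_inv_eq by trivial.
        unfold Rdiv; rewrite Rinv_mult, Rinv_inv; ring.
      - replace (Finite 1) with (Rbar_inv 1) by (simpl; f_equal; field).
        apply is_lim_inv; [apply is_lim_sinc_0|].
        intros e; injection e; lra. }
    exact L.
Qed.

(* [acos x = C * sqrt (1 - x) / (a + sqrt (1 + x))] at [x = cos (2 * t)] iff
   [C = ratio a t]. *)
Definition ratio (a t : R) : R := (sqrt 2 * a + 2 * cos t) * sinc_inv t.

Lemma ratio_0 (a : R) : ratio a 0 = 2 + sqrt 2 * a.
Proof. unfold ratio; rewrite sinc_inv_0, cos_0; ring. Qed.

Lemma ratio_PI4 (a : R) : ratio a (PI / 4) = PI * (1 + a) / 2.
Proof.
  assert (hpi := PI_RGT_0).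
  unfold ratio; rewrite sinc_inv_eq, <- sin_cos_PI4, sin_PI4 by lra.
  assert (hs := Rlt_sqrt2_0); assert (e := sqrt_sqrt 2 ltac:(lra)).
  field_simplify; [|lra].
  replace (sqrt 2 ^ 2) with 2 by (simpl; lra); field.
Qed.

Lemma continuity_ratio (a t : R) : 0 <= t <= PI / 2 -> continuity_pt (ratio a) t.
Proof.
  intros h; apply (continuity_pt_mult (fun t => sqrt 2 * a + 2 * cos t) sinc_inv).
  - apply (is_derive_continuity_pt _ _ (- (2 * sin t))); auto_derive; trivial; ring.
  - now apply continuity_sinc_inv.
Qed.

Definition ratio_deriv (a t : R) : R :=
  (sqrt 2 * a * (sin t - t * cos t) - 2 * (t - sin t * cos t)) / sin t ^ 2.

Lemma is_derive_ratio (a t : R) : 0 < t <= PI / 2 ->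
  is_derive (ratio a) t (ratio_deriv a t).
Proof.
  intros h; assert (hs := sin_pos t h).
  assert (hc : is_derive (fun t => sqrt 2 * a + 2 * cos t) t (- (2 * sin t))).
  { auto_derive; trivial; ring. }
  evar_last; [
    apply (is_derive_mult _ _ _ _ _ hc (is_derive_sinc_inv t h));
    intros; apply Rmult_comm|].
  unfold ratio_deriv; rewrite sinc_inv_eq by lra.
  assert (e := sin_cos_sqr t).
  apply (Rmult_eq_reg_r (sin t ^ 2)); [|apply pow_nonzero; lra].
  unfold plus, mult; simpl; field_simplify; [|lra|lra].
  assert (e' : sin t ^ 2 = 1 - cos t ^ 2) by (simpl; lra).
  ring [e'].
Qed.

Lemma ratio_deriv_crit (a t : R) : 0 < t <= PI / 2 ->
  ratio_deriv a t
    = (sqrt 2 * a - 2 * crit t) * ((sin t - t * cos t) / sin t ^ 2).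
Proof.
  intros h; assert (hs := sin_pos t h); assert (hd := x_cos_lt_sin t h).
  unfold ratio_deriv, crit; field; lra.
Qed.

Lemma ratio_deriv_factor_pos (t : R) :
  0 < t <= PI / 2 -> 0 < (sin t - t * cos t) / sin t ^ 2.
Proof.
  intros h; apply Rdiv_lt_0_compat; [now apply x_cos_lt_sin|].
  apply pow_lt, sin_pos, h.
Qed.

(** Continuity suffices at the ends, so [t = 0] is allowed and inner values can be compared with
    [ratio a 0]. *)
Lemma ratio_incr (a t u : R) : 0 <= t -> t < u -> u <= PI / 4 ->
  (forall v, t < v < u -> 2 * crit v < sqrt 2 * a) -> ratio a t < ratio a u.
Proof.
  intros ht htu hu h; assert (hpi := PI_RGT_0).
  apply (derive_pos_lt _ (ratio_deriv a)); trivial.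
  - intros x hx; apply continuity_ratio; lra.
  - intros x hx; apply is_derive_ratio; lra.
  - intros x hx; rewrite ratio_deriv_crit by lra.
    specialize (h x hx); apply Rmult_lt_0_compat; [lra|].
    apply ratio_deriv_factor_pos; lra.
Qed.

Lemma ratio_decr (a t u : R) : 0 <= t -> t < u -> u <= PI / 4 ->
  (forall v, t < v < u -> sqrt 2 * a < 2 * crit v) -> ratio a u < ratio a t.
Proof.
  intros ht htu hu h; assert (hpi := PI_RGT_0).
  apply (derive_neg_gt _ (ratio_deriv a)); trivial.
  - intros x hx; apply continuity_ratio; lra.
  - intros x hx; apply is_derive_ratio; lra.
  - intros x hx; rewrite ratio_deriv_crit by lra.
    specialize (h x hx).
    assert (hp := ratio_deriv_factor_pos x ltac:(lra)).
    apply Ropp_lt_cancel; rewrite Ropp_0, Ropp_mult_distr_l.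
    apply Rmult_lt_0_compat; lra.
Qed.

(** The value 2 is the limit of [crit] at 0, but no limit is taken: twice the denominator minus the
    numerator vanishes at 0 and has derivative [2 * sin t * (t - sin t)]. *)
Lemma crit_lt_2 (t : R) : 0 < t <= PI / 2 -> crit t < 2.
Proof.
  intros h; assert (hd := x_cos_lt_sin t h).
  assert (hn : 0 < 2 * (sin t - t * cos t) - (t - sin t * cos t)).
  { clear hd; revert t h.
    apply (derive_pos_pos _ (fun t => 2 * sin t * (t - sin t))).
    - rewrite sin_0; ring.
    - intros x; auto_derive; trivial.
      generalize (sin_cos_sqr x); nra.
    - intros x hx; apply Rmult_lt_0_compat.
      + generalize (sin_pos x); lra.
      + generalize (sin_lt_x x); lra. }
  unfold crit; apply (Rmult_lt_reg_r (sin t - t * cos t)); trivial.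
  unfold Rdiv; rewrite Rmult_assoc, Rinv_l by lra; lra.
Qed.

(** The origin of the threshold between cases (1) and (2). *)
Lemma crit_PI4 : 2 * crit (PI / 4) = sqrt 2 * (2 * (PI - 2) / (4 - PI)).
Proof.
  assert (hs := Rlt_sqrt2_0); assert (e := sqrt_sqrt 2 ltac:(lra)).
  assert (h4 := PI_lt_4).
  unfold crit; rewrite <- sin_cos_PI4, sin_PI4.
  replace (1 / sqrt 2 * (1 / sqrt 2)) with (1 / 2)
    by (rewrite <- e at 1; field; lra).
  field; repeat split; try lra.
Qed.

(** * The lower bound of case (2) *)

(* Cubing [1 < (cos t * T + 3 * T ^ (2/3)) / 4] with [T = sinc_inv t]: the
   minimum over [a > 0] of [ratio a t + 16 / a ^ 2] is
   [2 * cos t * T + 6 * T ^ (2/3)]. *)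
Lemma sinc_inv_sqr_lower (t : R) : 0 < t <= PI / 4 ->
  (4 - cos t * sinc_inv t) ^ 3 < 27 * sinc_inv t ^ 2.
Proof.
  intros ht; assert (hpi := PI_RGT_0).
  (* Since [k 0 = 27], it is enough that [k] decreases. *)
  set (k := fun t => (4 - cos t * sinc_inv t) ^ 3 / sinc_inv t ^ 2).
  assert (hT : forall x, 0 <= x <= PI / 4 -> 0 < sinc_inv x).
  { intros x [[h|<-] h']; [|rewrite sinc_inv_0; lra].
    rewrite sinc_inv_eq by lra; apply Rdiv_lt_0_compat; trivial.
    apply sin_pos; lra. }
  assert (hk : k t < k 0).
  { apply (derive_neg_gt k (fun x => (4 - cos x * sinc_inv x) ^ 2 / sinc_inv x ^ 3
      * ((3 * x * (x - sin x * cos x)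
          - 2 * (4 * sin x - x * cos x) * (sin x - x * cos x)) / sin x ^ 3))).
    - lra.
    - intros x hx; specialize (hT x ltac:(lra)).
      assert (hc := continuity_sinc_inv x ltac:(lra)).
      assert (hu : continuity_pt (fun x => 4 - cos x * sinc_inv x) x).
      { apply (continuity_pt_minus (fun _ => 4) (fun x => cos x * sinc_inv x)).
        - now apply continuity_pt_const.
        - apply (continuity_pt_mult cos sinc_inv); [apply continuity_cos|exact hc]. }
      apply (continuity_pt_div (fun x => (4 - cos x * sinc_inv x) ^ 3)
        (fun x => sinc_inv x ^ 2)).
      + apply (continuity_pt_comp _ (fun y => y ^ 3)); trivial.
        apply (is_derive_continuity_pt _ _ (3 * (4 - cos x * sinc_inv x) ^ 2));
          auto_derive; trivial; ring.
      + apply (continuity_pt_comp _ (fun y => y ^ 2)); trivial.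
        apply (is_derive_continuity_pt _ _ (2 * sinc_inv x));
          auto_derive; trivial; ring.
      + apply pow_nonzero; lra.
    - intros x hx; specialize (hT x ltac:(lra)).
      assert (hs := sin_pos x ltac:(lra)).
      assert (hd := is_derive_sinc_inv x ltac:(lra)).
      assert (hu : is_derive (fun x => 4 - cos x * sinc_inv x) x
        ((x - sin x * cos x) / sin x ^ 2)).
      { assert (hc : is_derive cos x (- sin x)) by (auto_derive; trivial; ring).
        evar_last.
        - apply (is_derive_minus (fun _ => 4) (fun x => cos x * sinc_inv x)).
          + apply is_derive_const.
          + apply (is_derive_mult _ _ _ _ _ hc hd); intros; apply Rmult_comm.
        - unfold minus, plus, opp, mult, zero; simpl.
          rewrite sinc_inv_eq by lra.
          apply (Rmult_eq_reg_r (sin x ^ 2)); [|apply pow_nonzero; lra].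
          field_simplify; [|lra|lra].
          assert (e' : cos x ^ 2 = 1 - sin x ^ 2)
            by (generalize (sin_cos_sqr x); simpl; lra).
          ring [e']. }
      evar_last.
      + apply is_derive_div; [apply is_derive_pow, hu|apply is_derive_pow, hd|].
        apply pow_nonzero; lra.
      + simpl; rewrite !sinc_inv_eq by lra; field; lra.
    - intros x hx; specialize (hT x ltac:(lra)).
      assert (hs := sin_pos x ltac:(lra)).
      assert (hd := x_cos_lt_sin x ltac:(lra)).
      assert (hp := trig_quartic_pos (2 * x) ltac:(lra)).
      rewrite sin_2a, cos_2a_sin in hp.
      assert (hn : 0 < 2 * (4 * sin x - x * cos x) * (sin x - x * cos x)
          - 3 * x * (x - sin x * cos x)).
      { replace (2 * (4 * sin x - x * cos x) * (sin x - x * cos x))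
          with (8 * sin x ^ 2 - 10 * (x * sin x * cos x)
            + 2 * x ^ 2 * (1 - sin x * sin x))
          by (rewrite <- (sin_cos_sqr x); ring).
        lra. }
      (* Keeps the squared factor of the derivative nonzero, so the inequality is strict. *)
      assert (hu : cos x * sinc_inv x < 4).
      { rewrite sinc_inv_eq by lra; apply (Rmult_lt_reg_r (sin x)); trivial.
        replace (cos x * (x / sin x) * sin x) with (x * cos x) by (field; lra).
        lra. }
      apply Ropp_lt_cancel; rewrite Ropp_0, Ropp_mult_distr_r.
      apply Rmult_lt_0_compat.
      + apply Rdiv_lt_0_compat; apply pow_lt; lra.
      + unfold Rdiv; rewrite Ropp_mult_distr_l; apply Rdiv_lt_0_compat.
        * lra.
        * now apply pow_lt. }
  unfold k in hk; rewrite sinc_inv_0, cos_0 in hk.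
  specialize (hT t ltac:(lra)).
  apply (Rmult_lt_compat_r (sinc_inv t ^ 2)) in hk; [|now apply pow_lt].
  unfold Rdiv in hk; rewrite Rmult_assoc, Rinv_l in hk by (apply pow_nonzero; lra).
  lra.
Qed.

Lemma ratio_lower (a t : R) : 0 < a -> 0 < t <= PI / 4 ->
  8 * (1 - 2 / a ^ 2) < ratio a t.
Proof.
  intros ha ht; assert (hpi := PI_RGT_0).
  assert (hk := sinc_inv_sqr_lower t ht).
  assert (hs := sin_pos t ltac:(lra)).
  assert (hd := x_cos_lt_sin t ltac:(lra)).
  unfold ratio; set (k := sinc_inv t) in *.
  (* A substitute for [k ^ (2/3)] that avoids cube roots: [sinc_inv_sqr_lower] gives
     [w ^ 3 < k ^ 2]. *)
  set (w := (4 - cos t * k) / 3).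
  assert (hk0 : 0 < k).
  { unfold k; rewrite sinc_inv_eq by lra; apply Rdiv_lt_0_compat; lra. }
  assert (hw : 0 < w).
  { unfold w, k; rewrite sinc_inv_eq by lra.
    replace ((4 - cos t * (t / sin t)) / 3) with (1 + (sin t - t * cos t) / sin t / 3)
      by (field; lra).
    assert (0 < (sin t - t * cos t) / sin t) by (apply Rdiv_lt_0_compat; lra).
    lra. }
  assert (hwk : w ^ 3 < k ^ 2) by (unfold w; nra).
  assert (hq := Rlt_sqrt2_0); assert (e := sqrt_sqrt 2 ltac:(lra)).
  set (A := sqrt 2 * a * k).
  assert (hA : 0 < A) by (unfold A; repeat apply Rmult_lt_0_compat; lra).
  assert (eA : A ^ 2 = 2 * a ^ 2 * k ^ 2) by (unfold A; ring [e]).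
  assert (hA2 : 0 < A ^ 2) by now apply pow_lt.
  replace (8 * (1 - 2 / a ^ 2)) with (8 - 32 * k ^ 2 / A ^ 2)
    by (rewrite eA; field; lra).
  enough (6 * w < A + 32 * k ^ 2 / A ^ 2) by (unfold A, w in *; lra).
  apply (Rmult_lt_reg_r (A ^ 2)); trivial.
  replace ((A + 32 * k ^ 2 / A ^ 2) * A ^ 2) with (A ^ 3 + 32 * k ^ 2)
    by (field; lra).
  (* AM-GM for [A / 2], [A / 2] and [32 * w ^ 3 / A ^ 2] in polynomial form: the product expands to
     [A ^ 3 - 6 * A ^ 2 * w + 32 * w ^ 3]. *)
  assert (0 <= (A - 4 * w) ^ 2 * (A + 2 * w))
    by (apply Rmult_le_pos; [apply pow2_ge_0|lra]).
  nra.
Qed.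

(** * Transfer from [ratio] to [acos] through [x = cos (2 * t)] *)

(** Half-angle formulas expose a common positive factor, which cancels when the two sides are
    compared. *)
Lemma carlson_ratio (a C t : R) : -1 <= a -> 0 < t < PI / 4 ->
  exists K, 0 < K /\ carlson a C (cos (2 * t)) = C * K
    /\ acos (cos (2 * t)) = ratio a t * K.
Proof.
  intros ha ht; assert (hpi := PI_RGT_0).
  assert (hs := sin_pos t ltac:(lra)).
  assert (hc : 0 < cos t) by (apply cos_gt_0; lra).
  assert (hst : sin t < cos t).
  { apply Rlt_trans with (sin (PI / 4)); [apply sin_increasing_1; lra|].
    rewrite sin_cos_PI4; apply cos_decreasing_1; lra. }
  assert (hq := Rlt_sqrt2_0); assert (e := sqrt_sqrt 2 ltac:(lra)).
  assert (e1 := sin_cos_sqr t).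
  assert (E1 : sqrt (1 - cos (2 * t)) = sqrt 2 * sin t).
  { rewrite cos_2a_sin.
    replace (1 - (1 - 2 * sin t * sin t)) with (2 * (sin t * sin t)) by ring.
    rewrite sqrt_mult, sqrt_square; nra. }
  assert (E2 : sqrt (1 + cos (2 * t)) = sqrt 2 * cos t).
  { rewrite cos_2a_cos.
    replace (1 + (2 * cos t * cos t - 1)) with (2 * (cos t * cos t)) by ring.
    rewrite sqrt_mult, sqrt_square; nra. }
  (* From [sin t < cos t] comes [2 * cos t ^ 2 > 1], hence [sqrt 2 * cos t > 1 >= - a]. *)
  assert (hp : 0 < a + sqrt 2 * cos t).
  { assert (0 < sqrt 2 * cos t) by (apply Rmult_lt_0_compat; lra). nra. }
  exists (sqrt 2 * sin t / (a + sqrt 2 * cos t)); repeat split.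
  - apply Rdiv_lt_0_compat; trivial; apply Rmult_lt_0_compat; lra.
  - unfold carlson; rewrite E1, E2; field; lra.
  - rewrite acos_cos by lra; unfold ratio; rewrite sinc_inv_eq by lra.
    replace (sqrt 2 * a + 2 * cos t) with (sqrt 2 * (a + sqrt 2 * cos t))
      by ring [e].
    transitivity (sqrt 2 * sqrt 2 * t); [rewrite e; ring|field; lra].
Qed.

Lemma carlson_lt_acos (a C t : R) : -1 <= a -> 0 < t < PI / 4 ->
  carlson a C (cos (2 * t)) < acos (cos (2 * t)) <-> C < ratio a t.
Proof.
  intros ha ht; destruct (carlson_ratio a C t ha ht) as [K [hK [-> ->]]].
  split; [now apply Rmult_lt_reg_r|now apply Rmult_lt_compat_r].
Qed.

Lemma acos_lt_carlson (a C t : R) : -1 <= a -> 0 < t < PI / 4 ->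
  acos (cos (2 * t)) < carlson a C (cos (2 * t)) <-> ratio a t < C.
Proof.
  intros ha ht; destruct (carlson_ratio a C t ha ht) as [K [hK [-> ->]]].
  split; [now apply Rmult_lt_reg_r|now apply Rmult_lt_compat_r].
Qed.

Lemma cos_double_in_01 (t : R) : 0 < t < PI / 4 -> 0 < cos (2 * t) < 1.
Proof.
  intros ht; assert (hpi := PI_RGT_0); split; [apply cos_gt_0; lra|].
  rewrite <- cos_0; apply cos_decreasing_1; lra.
Qed.

Lemma in_01_cos_double (x : R) :
  0 < x < 1 -> exists t, 0 < t < PI / 4 /\ x = cos (2 * t).
Proof.
  intros hx; exists (acos x / 2).
  assert (e := cos_acos x ltac:(lra)); assert (hb := acos_bound x).
  replace (2 * (acos x / 2)) with (acos x) by field; split; [|easy].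
  split.
  - destruct (Req_dec (acos x) 0) as [h|h]; [|lra].
    rewrite h, cos_0 in e; lra.
  - destruct (Rlt_le_dec (acos x) (PI / 2)) as [h|h]; [lra|].
    assert (cos (acos x) <= 0) by (apply cos_le_0; lra); lra.
Qed.

Lemma carlson_bounds (a C D : R) : -1 <= a ->
  (forall t, 0 < t < PI / 4 -> C < ratio a t < D) ->
  forall x, 0 < x < 1 -> carlson a C x < acos x < carlson a D x.
Proof.
  intros ha h x hx; destruct (in_01_cos_double x hx) as [t [ht ->]].
  rewrite carlson_lt_acos, acos_lt_carlson by trivial; now apply h.
Qed.

(** A constant valid on all of (0,1) is a lower bound of [ratio a] on the open interval, hence by
    continuity also at [e]. *)
Lemma best_possible_lower_endpoint (a e : R) : -1 <= a -> 0 <= e <= PI / 4 ->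
  best_possible_lower a (ratio a e).
Proof.
  intros ha he C' hC h; assert (hpi := PI_RGT_0).
  enough (C' <= ratio a e) by lra.
  apply (continuity_ge_endpoint (ratio a) 0 (PI / 4)); trivial; [lra| |].
  - apply continuity_ratio; lra.
  - intros t ht; apply Rlt_le, carlson_lt_acos; trivial.
    now apply h, cos_double_in_01.
Qed.

Lemma best_possible_upper_endpoint (a e : R) : -1 <= a -> 0 <= e <= PI / 4 ->
  best_possible_upper a (ratio a e).
Proof.
  intros ha he C' hC h; assert (hpi := PI_RGT_0).
  enough (ratio a e <= C') by lra.
  apply (continuity_le_endpoint (ratio a) 0 (PI / 4)); trivial; [lra| |].
  - apply continuity_ratio; lra.
  - intros t ht; apply Rlt_le, acos_lt_carlson; trivial.
    now apply h, cos_double_in_01.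
Qed.

Theorem theorem2 (a : R) :
  (* [-1 <= a]: positivity of [a + sqrt (1 + x)] for all [x] in (0,1) *)
  (-1 <= a -> a <= 2 * (PI - 2) / (4 - PI) ->
     (forall x, 0 < x < 1 ->
        carlson a (PI * (1 + a) / 2) x < acos x < carlson a (2 + sqrt 2 * a) x)
     /\ best_possible_lower a (PI * (1 + a) / 2)
     /\ best_possible_upper a (2 + sqrt 2 * a))
  /\
  (2 * (PI - 2) / (4 - PI) < a < 2 * sqrt 2 ->
     (forall x, 0 < x < 1 ->
        carlson a (8 * (1 - 2 / a ^ 2)) x < acos x
          < carlson a (Rmax (2 + sqrt 2 * a) (PI * (1 + a) / 2)) x)
     /\ best_possible_upper a (Rmax (2 + sqrt 2 * a) (PI * (1 + a) / 2)))
  /\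
  (2 * sqrt 2 <= a ->
     (forall x, 0 < x < 1 ->
        carlson a (2 + sqrt 2 * a) x < acos x < carlson a (PI * (1 + a) / 2) x)
     /\ best_possible_lower a (2 + sqrt 2 * a)
     /\ best_possible_upper a (PI * (1 + a) / 2)).
Proof.
  assert (hq := Rlt_sqrt2_0); assert (e := sqrt_sqrt 2 ltac:(lra)).
  assert (hpi := PI_RGT_0).
  rewrite <- (ratio_0 a), <- (ratio_PI4 a).
  split; [|split].
  - intros ha h; split; [|split].
    + assert (hc : forall v, 0 < v < PI / 4 -> sqrt 2 * a < 2 * crit v).
      { intros v hv.
        assert (hd := crit_decr v (PI / 4) ltac:(lra) ltac:(lra) ltac:(lra)).
        apply (Rmult_le_compat_l (sqrt 2)) in h; [|lra].
        rewrite <- crit_PI4 in h; lra. }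
      apply carlson_bounds; trivial; intros t ht; split; apply ratio_decr;
        try lra; intros v hv; apply hc; lra.
    + apply best_possible_lower_endpoint; lra.
    + apply best_possible_upper_endpoint; lra.
  - intros [h1 h2].
    assert (ha : 0 < a).
    { apply Rle_lt_trans with (2 := h1); generalize PI2_3_2 PI_lt_4; intros.
      apply Rlt_le, Rdiv_lt_0_compat; lra. }
    split.
    + apply carlson_bounds; [lra|]; intros t ht; split.
      * apply ratio_lower; lra.
      (* The turning point need not be located: [crit] decreases, so the sign at [t] makes [ratio a]
         decrease on all of [[0, t]] or increase on all of [[t, PI / 4]]. *)
      * destruct (Rle_lt_dec (sqrt 2 * a) (2 * crit t)) as [h|h].
        -- apply Rlt_le_trans with (2 := Rmax_l _ _).
           apply ratio_decr; try lra; intros v hv.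
           generalize (crit_decr v t); lra.
        -- apply Rlt_le_trans with (2 := Rmax_r _ _).
           apply ratio_incr; try lra; intros v hv.
           generalize (crit_decr t v); lra.
    (* Whichever term is the maximum, it is an end value of [ratio a]. *)
    + apply Rmax_case; apply best_possible_upper_endpoint; lra.
  - intros h; assert (ha : -1 <= a) by lra.
    assert (hc : forall v, 0 < v < PI / 4 -> 2 * crit v < sqrt 2 * a).
    (* Here [sqrt 2 * a >= 4], and 4 exceeds [2 * crit v]. *)
    { intros v hv; assert (hd := crit_lt_2 v ltac:(lra)); nra. }
    split; [|split].
    + apply carlson_bounds; trivial; intros t ht; split; apply ratio_incr;
        try lra; intros v hv; apply hc; lra.
    + apply best_possible_lower_endpoint; lra.
    + apply best_possible_upper_endpoint; lra.
Qed.
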